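(* Let $R$ be a polynomial ring in finitely many variables over a field, let $I \subseteq R$ be a proper ideal, and let $>$ be a term order on $R$. Suppose that $\{b_{i,j} \mid 1 \leq i \leq q,\ 0 \leq j \leq t_i\}$ are distinct variables of $R$ such that $b_{i,0} > b_{i,j}$ for all $1 \leq i \leq q$ and all $1\le j\le t_i$. Assume further that: (1) $d_{b_{i,j}}(\mathrm{in}_{>}(I)) \leq 1$ for all $1\le i\le q$ and $1\le j \le t_i$; and (2) for each $i = 1, \ldots, q$, if $M$ is a minimal monomial generator of $\mathrm{in}_{>}(I)$ and $b_{i,0}$ divides $M$, then there exists $j \geq 1$ such that $b_{i,j}$ divides $M$. Let $f_i = \sum_{j=0}^{t_i} b_{i,j}$ for $1 \leq i \leq q$. Then $f_1, \ldots, f_q$ is an initially regular sequence on $R/I$ (with respect to the single term order $>$). In particular, $\mathrm{depth}\, R/I \geq q$.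
   Context: $\mathfrak m$ is the ideal of $R$ generated by all the variables. A term order is a monomial order (a total order on monomials, compatible with multiplication, with $1$ smallest), and $\mathrm{in}_>(J)$ is the initial ideal of $J$ with respect to $>$. For a monomial ideal $J$ and a variable $x$, $d_x(J)$ is the maximum exponent of $x$ in the minimal monomial generators of $J$ (and $0$ if $J=0$). An element $f\in\mathfrak m$ is regular on $R/J$ if it is a non-zerodivisor on $R/J$. For a proper ideal $I$ and a term order $>$, a sequence of nonconstant polynomials $f_1,\dots,f_q \in \mathfrak m$ is an initially regular sequence on $R/I$ (with respect to $>$) if for each $i=1,\dots,q$, $f_i$ is a regular element on $R/I_i$, where $I_1=\mathrm{in}_{>}(I)$ and $I_i=\mathrm{in}_{>}\big((I_{i-1},f_{i-1})\big)$ for $i\ge 2$. Depth is taken with respect to $\mathfrak m$: $\mathrm{depth}\,R/I=\min\{d \mid \mathrm{Ext}^d_R(R/\mathfrak m,R/I)\neq 0\}$ ($+\infty$ if all these vanish). *)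

(* Defs.v *)
(* Ideals are boolean predicates; classically (`[< _ >] of boolp) every proper
   ideal is of this form, so [idealr R] is the type of all proper ideals of R. *)
From HB Require Import structures.
From mathcomp Require Import all_boot all_order all_algebra.
From mathcomp Require Import generic_quotient ring_quotient.
From mathcomp Require Import boolp.
From mathcomp Require Import mpoly freeg.

Set Implicit Arguments.
Unset Strict Implicit.
Unset Printing Implicit Defensive.

Import GRing.Theory.

Local Open Scope ring_scope.
Local Open Scope quotient_scope.

Section IdealQuotientModule.
Variables (R : comNzRingType) (I : idealr R).

Definition quot_scale (a : R) (x : {ideal_quot I}) : {ideal_quot I} :=
  \pi_{ideal_quot I} a * x.

Fact quot_scaleA a b x : quot_scale a (quot_scale b x) = quot_scale (a * b) x.
Proof. by rewrite /quot_scale mulrA -rmorphM. Qed.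

Fact quot_scale1 : left_id 1 quot_scale.
Proof. by move=> x; rewrite /quot_scale rmorph1 mul1r. Qed.

Fact quot_scaleDr : right_distributive quot_scale +%R.
Proof. by move=> a x y; rewrite /quot_scale mulrDr. Qed.

Fact quot_scaleDl x : {morph quot_scale^~ x : a b / a + b}.
Proof. by move=> a b; rewrite /quot_scale rmorphD mulrDl. Qed.

HB.instance Definition _ := GRing.Zmodule_isLmodule.Build R {ideal_quot I}
  quot_scaleA quot_scale1 quot_scaleDr quot_scaleDl.

End IdealQuotientModule.

Section Ext.
Variable R : nzRingType.

Definition projective (P : lmodType R) : Prop :=
  forall (A B : lmodType R) (g : {linear A -> B}) (h : {linear P -> B}),
    (forall b, exists a, g a = b) ->
    exists h' : {linear P -> A}, forall x, g (h' x) = h x.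

Record proj_resolution (M : lmodType R) := ProjResolution {
  pr_mod : nat -> lmodType R;
  pr_diff : forall i, {linear pr_mod i.+1 -> pr_mod i};
  pr_aug : {linear pr_mod 0 -> M};
  pr_projective : forall i, projective (pr_mod i);
  pr_aug_surj : forall y, exists x, pr_aug x = y;
  pr_exact0 : forall x, pr_aug x = 0 <-> exists y, pr_diff 0 y = x;
  pr_exactS : forall i x, pr_diff i x = 0 <-> exists y, pr_diff i.+1 y = x
}.

Section Cohomology.
Variables (M N : lmodType R) (P : proj_resolution M).

Definition cocycle (d : nat) (phi : {linear pr_mod P d -> N}) : Prop :=
  forall x, phi (pr_diff P d x) = 0.

Definition coboundary (d : nat) : {linear pr_mod P d -> N} -> Prop :=
  match d with
  | 0 => fun phi => forall x, phi x = 0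
  | e.+1 => fun phi => exists psi : {linear pr_mod P e -> N},
              forall x, phi x = psi (pr_diff P e x)
  end.

End Cohomology.

(* H^d(Hom_R(P, N)) <> 0 for a projective resolution P of M; the choice of P
   does not matter, and one exists by [proj_resolution_exists]. *)
Definition Ext_neq0 (d : nat) (M N : lmodType R) : Prop :=
  exists (P : proj_resolution M) (phi : {linear pr_mod P d -> N}),
    cocycle phi /\ ~ coboundary phi.

(* [None] stands for +oo. *)
Definition ext_depth (k N : lmodType R) : option nat :=
  match pselect (exists d, `[< Ext_neq0 d k N >]) with
  | left ex => Some (ex_minn ex)
  | right _ => None
  end.

End Ext.

Definition natbar_ge (d : option nat) (q : nat) : Prop :=
  if d is Some e then (q <= e)%N else True.

Section ResolutionExists.
Variable R : nzRingType.

Section FreeModule.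
Variables (K : choiceType) (M : lmodType R) (f : K -> M).

Fact fglift_zmod_morphism : zmod_morphism (fglift f).
Proof. exact: lift_is_additive. Qed.

Fact fglift_scalable : scalable (fglift f).
Proof.
have fB := fglift_zmod_morphism.
have f0 : fglift f 0 = 0 by rewrite -(subrr 0) fB subrr.
have fN : {morph fglift f : x / - x} by move=> x; rewrite -sub0r fB f0 sub0r.
have fD : {morph fglift f : x y / x + y}.
  by move=> x y; rewrite -{1}[y]opprK fB fN opprK.
have fS (s : seq K) (F : K -> {freeg K / R}) :
    fglift f (\sum_(i <- s) F i) = \sum_(i <- s) fglift f (F i).
  exact: (big_morph _ fD f0).
move=> a D; rewrite -[in RHS](freeg_sumE D).
have -> : a *: D = \sum_(x <- dom D) << a * coeff x D *g x >> by [].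
rewrite !fS scaler_sumr; apply: eq_bigr => x _.
by rewrite !liftU scalerA.
Qed.

HB.instance Definition _ :=
  GRing.isZmodMorphism.Build {freeg K / R} M (fglift f) fglift_zmod_morphism.
HB.instance Definition _ :=
  GRing.isScalable.Build R {freeg K / R} M *:%R (fglift f) fglift_scalable.

End FreeModule.

Lemma fglift_unique (K : choiceType) (M : lmodType R)
    (g h : {linear {freeg K / R} -> M}) :
  (forall x, g << x >> = h << x >>) -> g =1 h.
Proof.
move=> gh D; rewrite -(freeg_sumE D) !raddf_sum; apply: eq_bigr => x _.
have -> : << coeff x D *g x >> = coeff x D *: << x >> :> {freeg K / R}.
  by apply/eqP/freeg_eqP => y; rewrite coeffZ !coeffU mul1r.
by rewrite [LHS]linearZZ [RHS]linearZZ gh.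
Qed.

Lemma freeg_projective (K : choiceType) : projective {freeg K / R}.
Proof.
move=> A B g h gsurj.
have [f fP] : exists f : K -> A, forall x, g (f x) = h << x >>.
  have /boolp.choice[f fP] : forall x, exists a, g a = h << x >> by [].
  by exists f.
exists (fglift f).
apply: (fglift_unique (g := g \o fglift f) (h := h)) => x /=.
by rewrite liftU scale1r fP.
Qed.

Section Kernel.
Variables (M N : lmodType R) (f : {linear M -> N}).

Definition lin_ker : {pred M} := fun x => f x == 0.

Fact lin_ker_submod : submod_closed lin_ker.
Proof.
split=> [|a x y]; rewrite !unfold_in ?linear0 // => /eqP fx /eqP fy.
by rewrite linearP fx fy scaler0 addr0.
Qed.

HB.instance Definition _ := GRing.isSubmodClosed.Build R M lin_ker lin_ker_submod.

Record kernel := Kernel { ker_val :> M; _ : ker_val \in lin_ker }.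

HB.instance Definition _ := [isSub for ker_val].
HB.instance Definition _ := [Choice of kernel by <:].
HB.instance Definition _ := [SubChoice_isSubLmodule of kernel by <:].

End Kernel.

Definition syzygy (M : lmodType R) : lmodType R :=
  kernel (fglift (id : M -> M)).

Lemma proj_resolution_exists (M : lmodType R) : inhabited (proj_resolution M).
Proof.
pose S i := iter i syzygy M.
pose P i : lmodType R := {freeg (S i) / R}.
pose eps i : {linear P i -> S i} := fglift (id : S i -> S i).
pose iota i : {linear S i.+1 -> P i} := val.
have eps_surj i y : exists x, eps i x = y.
  by exists << y >>; rewrite /eps /= liftU scale1r.
have exact i x : eps i x = 0 <-> exists y, iota i (eps i.+1 y) = x.
  split=> [ex|[y <-]]; last by apply/eqP; exact: (valP (eps i.+1 y)).
  have kx : x \in lin_ker (eps i) by rewrite unfold_in; exact/eqP.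
  have [y yx] := eps_surj i.+1 (Kernel kx : S i.+1).
  by exists y; rewrite yx.
constructor; exists P (fun i => iota i \o eps i.+1) (eps 0%N).
- by move=> i; exact: freeg_projective.
- exact: eps_surj.
- exact: exact.
move=> i x; rewrite -exact /=; split=> [x0|->]; last exact: (linear0 (iota i)).
by apply: val_inj; exact: etrans x0 (esym (linear0 (iota i))).
Qed.

End ResolutionExists.

Section Ideals.
Variables (n : nat) (k : fieldType).
Local Notation R := {mpoly k[n]}.
Implicit Types (J : {pred R}) (f g p : R) (M : 'X_{1..n}).

Definition ideal_gen (S : R -> Prop) : {pred R} := fun p =>
  `[< exists2 s : seq (R * R), forall x, x \in s -> S x.2
        & p = \sum_(x <- s) x.1 * x.2 >].

Lemma ideal_genP (S : R -> Prop) p :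
  reflect (exists2 s : seq (R * R), forall x, x \in s -> S x.2
             & p = \sum_(x <- s) x.1 * x.2)
          (p \in ideal_gen S).
Proof. exact: asboolP. Qed.

Definition mvars_ideal : {pred R} := ideal_gen (fun g => exists i, g = 'X_i).

Fact mvars_ideal_closed : idealr_closed mvars_ideal.
Proof.
split.
- by apply/ideal_genP; exists [::]; rewrite ?big_nil.
- apply/negP => /ideal_genP[s sX] /(congr1 (meval (fun _ => 0))).
  rewrite rmorph1 rmorph_sum big1_seq /= => [/eqP|x /sX[i ->]].
    by rewrite oner_eq0.
  by rewrite rmorphM /= mevalXU mulr0.
- move=> a u v /ideal_genP[s sX ->] /ideal_genP[t tX ->].
  apply/ideal_genP; exists ([seq (a * x.1, x.2) | x <- s] ++ t).
    by move=> x; rewrite mem_cat => /orP[/mapP[y /sX yX ->]|/tX].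
  rewrite big_cat big_map mulr_sumr /=; congr (_ + _).
  by apply: eq_bigr => x _; rewrite mulrA.
Qed.

HB.instance Definition _ := isIdealr.Build R mvars_ideal mvars_ideal_closed.

Record term_order (le : rel 'X_{1..n}) : Prop := TermOrder {
  to_refl : reflexive le;
  to_anti : antisymmetric le;
  to_trans : transitive le;
  to_total : total le;
  to_1 : forall M, le 0%MM M;
  to_mul : forall M1 M2 M, le M1 M2 -> le (M1 + M)%MM (M2 + M)%MM
}.

Definition is_lead_monomial (le : rel 'X_{1..n}) f M : Prop :=
  M \in msupp f /\ forall M', M' \in msupp f -> le M' M.

Definition monomial_ideal (G : 'X_{1..n} -> Prop) : {pred R} :=
  ideal_gen (fun g => exists2 M, G M & g = 'X_[M]).

Definition initial_ideal (le : rel 'X_{1..n}) J : {pred R} :=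
  monomial_ideal (fun M => exists2 f, f \in J & is_lead_monomial le f M).

Definition is_min_monomial_gens J (G : 'X_{1..n} -> Prop) : Prop :=
  J =i monomial_ideal G /\
  forall G' : 'X_{1..n} -> Prop, (forall M, G' M -> G M) ->
    J =i monomial_ideal G' -> forall M, G M -> G' M.

Definition min_monomial_gen J M : Prop :=
  exists2 G, is_min_monomial_gens J G & G M.

(* d_x(J) for x = 'X_i and a monomial ideal J, as a least upper bound: it is 0
   if there are no generators (J = 0). A monomial ideal has finitely many
   minimal generators, so the [right] branch is not reached for it. *)
Definition max_exponent J (i : 'I_n) : nat :=
  match pselect (exists e, `[< forall M, min_monomial_gen J M -> (M i <= e)%N >])
  with
  | left ex => ex_minn ex
  | right _ => 0%N
  end.

Definition regular_on J f : Prop :=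
  f \in mvars_ideal /\ forall g, f * g \in J -> g \in J.

Definition add_gen J f : {pred R} := ideal_gen (fun g => g \in J \/ g = f).

(* [init_chain le I fs i] is the ideal I_{i+1} of the definition of an initially
   regular sequence: both i and the entries of fs are numbered from 0. *)
Fixpoint init_chain (le : rel 'X_{1..n}) (I : {pred R}) (fs : seq R) (i : nat) :
    {pred R} :=
  match i with
  | 0 => initial_ideal le I
  | j.+1 => initial_ideal le (add_gen (init_chain le I fs j) fs`_j)
  end.

Definition initially_regular (le : rel 'X_{1..n}) (I : {pred R}) (fs : seq R) :
    Prop :=
  forall i, (i < size fs)%N ->
    (forall c : k, fs`_i <> c%:MP) /\ regular_on (init_chain le I fs i) fs`_i.

Definition depth (I : idealr R) : option nat :=
  ext_depth {ideal_quot mvars_ideal} {ideal_quot I}.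

End Ideals.

(* Main.v *)
(* Call J reducible at x on a set P of monomials if N in J implies N / x in J
   for all N in P. The hypotheses on the generators of J = in(I) say that J is
   reducible at b_{i,j}, j >= 1, on the monomials divisible by b_{i,j}^2, and at
   b_{i,0} on the monomials divisible by b_{i,0} but by no b_{i,j} with j >= 1.
   These properties make f_i regular on R/J, and for the remaining indices they
   pass to in(J, f_i), because f_i does not involve the variables concerned.

   For the depth, the vanishing of Koszul cohomology of R/J (with respect to all
   the variables) in degrees below q passes from in(J) to J, by subtracting
   leading forms, and from (J, f) in degrees below q to J in degrees below q+1
   when f is regular on R/J. Finally, if the Koszul complex
   N -> K^1(N) -> K^2(N) -> ... is exact below degree q, a zigzag through the
   groups Hom(P_a, K^b(N)) shows that every cocycle P_d -> N with d < q is a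
   coboundary, for any projective resolution P of R/m: a variable multiplies
   cocycles into coboundaries, and the P_a are projective. *)
Require Import Defs.
From HB Require Import structures.
From mathcomp Require Import all_boot all_order all_algebra.
From mathcomp Require Import generic_quotient ring_quotient.
From mathcomp Require Import boolp.
From mathcomp Require Import mpoly.
From mathcomp Require Import zify.

Set Implicit Arguments.
Unset Strict Implicit.
Unset Printing Implicit Defensive.

Import GRing.Theory.

Local Open Scope ring_scope.
Local Open Scope quotient_scope.

Lemma total_seq_max (T : eqType) (r : rel T) (s : seq T) :
  transitive r -> total r -> s != [::] ->
  exists2 x, x \in s & {in s, forall y, r y x}.
Proof.
move=> r_tr r_tot; have r_refl x : r x x by have /orP[] := r_tot x x.
elim: s => // x [|y s] IHs _.
  by exists x; rewrite ?inE // => y; rewrite inE => /eqP->.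
have [//|z zs zmax] := IHs; have /orP[xz|zx] := r_tot x z.
  exists z; first by rewrite inE zs orbT.
  by move=> u; rewrite inE => /orP[/eqP->|/zmax].
exists x; rewrite ?inE ?eqxx // => u.
by rewrite inE => /orP[/eqP->//|/zmax uz]; apply: r_tr uz zx.
Qed.

(** * Dickson's lemma and induction along a term order *)

Section Monomials.
Variable n : nat.
Implicit Types (M N : 'X_{1..n}) (G : 'X_{1..n} -> Prop).

(** A set [B0] that serves the other coordinates serves every [M] whose exponent at [i] is at least
    the maximum [E] of that exponent on [B0]. Each of the finitely many slices [M i = e] with
    [e < E] is served by the induction hypothesis. *)
Lemma dickson_on (l : seq 'I_n) G :
  exists2 B : seq 'X_{1..n}, {in B, forall M, G M} &
    forall M, G M -> exists2 N, N \in B & {in l, forall i, (N i <= M i)%N}.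
Proof.
elim: l G => [|i l IHl] G.
  have [[M GM]|noG] := pselect (exists M, G M).
    by exists [:: M] => [N|N _]; [rewrite inE => /eqP-> | exists M; rewrite ?inE].
  by exists [::] => // M GM; case: noG; exists M.
have [B0 B0G B0P] := IHl G.
have /boolp.choice[B BP] : forall e, exists B : seq 'X_{1..n},
    {in B, forall M, G M /\ M i = e} /\ (forall M, G M /\ M i = e ->
      exists2 N, N \in B & {in l, forall i, (N i <= M i)%N}).
  by move=> e; have [B] := IHl (fun M => G M /\ M i = e); exists B.
pose E := (\max_(N <- B0) N i)%N.
exists (B0 ++ flatten [seq B e | e <- iota 0 E]).
  move=> M; rewrite mem_cat => /orP[/B0G //|/flattenP[s /mapP[e _ ->]]].
  by have [BG _] := BP e; case/BG.
move=> M GM; have [leE|ltE] := leqP E (M i).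
  have [N NB NM] := B0P M GM; exists N; first by rewrite mem_cat NB.
  move=> j; rewrite inE => /orP[/eqP->|/NM //].
  by apply: leq_trans leE; rewrite /E (big_rem _ NB) leq_maxl.
have [BG BM] := BP (M i); have [//|N NB NM] := BM M.
exists N.
  rewrite mem_cat; apply/orP; right; apply/flattenP; exists (B (M i)) => //.
  by apply: map_f; rewrite mem_iota.
move=> j; rewrite inE => /orP[/eqP->|/NM //].
by have [_ ->] := BG N NB.
Qed.

Lemma dickson G :
  exists2 B : seq 'X_{1..n}, {in B, forall M, G M} &
    forall M, G M -> exists2 N, N \in B & (N <= M)%MM.
Proof.
have [B BG BP] := dickson_on (enum 'I_n) G; exists B => // M /BP[N NB NM].
by exists N => //; apply/mnm_lepP => i; apply: NM; rewrite mem_enum.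
Qed.

Variable le : rel 'X_{1..n}.
Hypothesis leT : term_order le.

Lemma to_dvd M N : (M <= N)%MM -> le M N.
Proof.
move=> /submK <-; rewrite -{1}[M]add0m; apply: to_mul leT _ _ _ _.
exact: to_1 leT _.
Qed.

Lemma to_cancel M N K : le (M + K)%MM (N + K)%MM -> le M N.
Proof.
move=> MN; have /orP[//|NM] := to_total leT M N.
have /addIm-> : (M + K = N + K)%MM.
  by apply: (to_anti leT); rewrite MN (to_mul leT).
exact: to_refl leT _.
Qed.

(** By Dickson's lemma finitely many counterexamples divide all others, and divisors are smaller, so
    the least of these few is the least counterexample. *)
Lemma to_ind (P : 'X_{1..n} -> Prop) :
  (forall M, (forall N, le N M -> N != M -> P N) -> P M) -> forall M, P M.
Proof.
move=> IH; apply: contrapT => /existsNP[M0 nP].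
have [B BG BP] := dickson (fun M => ~ P M).
have Bn : B != [::] by have [N + _] := BP M0 nP; case: (B).
have [||//|M MB Mmin] := @total_seq_max _ (fun M N => le N M) B.
- by move=> M N K NM KM; apply: to_trans leT _ _ _ KM NM.
- by move=> M N; have := to_total leT N M.
apply: (BG M MB); apply: IH => N NM neq; apply: contrapT => nPN.
have [K KB KN] := BP N nPN; case/eqP: neq; apply: (to_anti leT); rewrite NM /=.
exact: to_trans leT _ _ _ (Mmin K KB) (to_dvd KN).
Qed.

End Monomials.

(** * Polynomials restricted to a set of monomials; monomial and initial ideals *)

Section Ideals.
Variables (n : nat) (k : fieldType).
Local Notation R := {mpoly k[n]}.
Implicit Types (J : {pred R}) (f g h p : R) (M N K : 'X_{1..n}).
Implicit Types (P : pred 'X_{1..n}) (G : 'X_{1..n} -> Prop).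

Definition mfilter P p : R := \sum_(M <- msupp p | P M) p@_M *: 'X_[M].

Lemma mcoeff_mfilter P p N : (mfilter P p)@_N = if P N then p@_N else 0.
Proof.
rewrite /mfilter raddf_sum /= (eq_bigr (fun M => p@_M * (M == N)%:R)); last first.
  by move=> M _; rewrite mcoeffZ mcoeffX.
have [Np|Np] := boolP (N \in msupp p); last first.
  rewrite (memN_msupp_eq0 Np) if_same big1_seq // => M /andP[_ Mp].
  by case: eqP Np => [<-|_]; rewrite ?Mp ?mulr0.
rewrite big_mkcond (bigD1_seq N) ?msupp_uniq //= eqxx mulr1 big1 ?addr0 //.
by move=> M /negPf->; rewrite mulr0 if_same.
Qed.

Lemma msupp_mfilter P p N : (N \in msupp (mfilter P p)) = P N && (N \in msupp p).
Proof. by rewrite !mcoeff_msupp mcoeff_mfilter; case: ifP; rewrite ?eqxx. Qed.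

Lemma mfilter_split P p : p = mfilter P p + mfilter (predC P) p.
Proof.
apply/mpolyP => M; rewrite mcoeffD !mcoeff_mfilter /=.
by case: (P M); rewrite ?addr0 ?add0r.
Qed.

Lemma mfilterD P p h : mfilter P (p + h) = mfilter P p + mfilter P h.
Proof.
by apply/mpolyP=> M; rewrite mcoeffD !mcoeff_mfilter mcoeffD; case: ifP; rewrite ?addr0.
Qed.

Lemma mfilterM P f g :
  {in msupp f, forall M N, P (N + M)%MM = P N} -> mfilter P (g * f) = mfilter P g * f.
Proof.
move=> Pf; rewrite {1}[g](mfilter_split P) mulrDl mfilterD.
have PM b : {in msupp (mfilter (fun N => P N == b) g * f), forall N, P N = b}.
  move=> N /msuppM_le/allpairsP[[K L] /= [+ Lf ->]].
  by rewrite msupp_mfilter => /andP[/eqP PK _]; rewrite Pf.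
rewrite -[RHS]addr0; congr (_ + _).
  apply/mpolyP => N; rewrite mcoeff_mfilter; case: ifPn => // /negPf PN.
  have -> : mfilter P g = mfilter (fun N => P N == true) g.
    by apply: eq_bigl => K; rewrite eqb_id.
  apply/esym/memN_msupp_eq0; apply: contraFN PN; exact: (PM true).
apply/mpolyP => N; rewrite mcoeff_mfilter mcoeff0; case: ifPn => // PN.
apply: memN_msupp_eq0; apply: contraTN PN => NP; apply/negPf/(PM false).
by move: NP; congr (_ \in msupp (_ * _)); apply: eq_bigl => K /=; case: (P K).
Qed.

Lemma mpolyX_dvd K g :
  {in msupp g, forall M, (K <= M)%MM} -> exists h, g = h * 'X_[K].
Proof.
move=> Kg; exists (\sum_(M <- msupp g) g@_M *: 'X_[M - K]).
rewrite [LHS]mpolyE mulr_suml [LHS]big_seq [RHS]big_seq.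
by apply: eq_bigr => M Mg; rewrite -scalerAl -mpolyXD submK ?Kg.
Qed.

Lemma mem_msuppMX h K N : (N \in msupp h) = ((N + K)%MM \in msupp (h * 'X_[K])).
Proof. by rewrite !mcoeff_msupp addmC mcoeffMX. Qed.

(** Properness is left out, so that every [ideal_gen S] qualifies. *)
Definition is_ideal J : Prop :=
  [/\ 0 \in J, {in J &, forall u v, u + v \in J} & forall a, {in J, forall u, a * u \in J}].

Lemma ideal0 J : is_ideal J -> 0 \in J. Proof. by case. Qed.

Lemma idealD J : is_ideal J -> {in J &, forall u v, u + v \in J}. Proof. by case. Qed.

Lemma idealM J : is_ideal J -> forall a, {in J, forall u, a * u \in J}.
Proof. by case. Qed.

Lemma idealN J : is_ideal J -> {in J, forall u, - u \in J}.
Proof. by move=> Ji u uJ; rewrite -mulN1r idealM. Qed.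

Lemma idealB J : is_ideal J -> {in J &, forall u v, u - v \in J}.
Proof. by move=> Ji u v uJ vJ; rewrite idealD // idealN. Qed.

Lemma idealZ J : is_ideal J -> forall c : k, {in J, forall u, c *: u \in J}.
Proof. by move=> Ji c u uJ; rewrite -mul_mpolyC idealM. Qed.

Lemma ideal_sum J : is_ideal J -> forall (T : eqType) (s : seq T) (F : T -> R),
  {in s, forall x, F x \in J} -> \sum_(x <- s) F x \in J.
Proof.
move=> Ji T s F FJ; rewrite big_seq.
apply: (big_ind (fun u => u \in J)) => // [|u v].
  exact: ideal0.
exact: idealD.
Qed.

Lemma ideal_gen_ideal (S : R -> Prop) : is_ideal (ideal_gen S).
Proof.
split=> [|u v|a u].
- by apply/ideal_genP; exists [::]; rewrite ?big_nil.
- move=> /ideal_genP[s sS ->] /ideal_genP[t tS ->].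
  apply/ideal_genP; exists (s ++ t); last by rewrite big_cat.
  by move=> x; rewrite mem_cat => /orP[/sS|/tS].
move=> /ideal_genP[s sS ->]; apply/ideal_genP.
exists [seq (a * x.1, x.2) | x <- s].
  by move=> x /mapP[y /sS yS ->].
by rewrite big_map mulr_sumr; apply: eq_bigr => x _; rewrite mulrA.
Qed.

Lemma mem_ideal_gen (S : R -> Prop) g : S g -> g \in ideal_gen S.
Proof.
move=> Sg; apply/ideal_genP; exists [:: (1, g)]; last by rewrite big_seq1 mul1r.
by move=> x; rewrite inE => /eqP->.
Qed.

Lemma add_genP J f p : is_ideal J ->
  reflect (exists2 j, j \in J & exists g, p = j + g * f) (p \in add_gen J f).
Proof.
move=> Ji; apply: (iffP idP) => [|[j jJ [g ->]]]; last first.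
  have Ai := ideal_gen_ideal (fun g => g \in J \/ g = f).
  apply: idealD => //; first by apply: mem_ideal_gen; left.
  by apply: idealM => //; apply: mem_ideal_gen; right.
move=> /ideal_genP[s sJ ->]; elim: s sJ => [|x s IHs] sJ.
  by exists 0; [exact: ideal0 | exists 0; rewrite big_nil mul0r addr0].
rewrite big_cons; have [|j jJ [g ->]] := IHs.
  by move=> y ys; apply: sJ; rewrite inE ys orbT.
have [xJ|->] : x.2 \in J \/ x.2 = f by apply: sJ; rewrite inE eqxx.
  by exists (x.1 * x.2 + j); [rewrite idealD // idealM | exists g; rewrite addrA].
by exists j => //; exists (x.1 + g); rewrite mulrDl addrCA.
Qed.

Definition is_monomial_ideal J : Prop :=
  is_ideal J /\ {in J, forall p, {in msupp p, forall M, 'X_[M] \in J}}.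

Lemma mem_of_msupp J p :
  is_ideal J -> {in msupp p, forall M, 'X_[M] \in J} -> p \in J.
Proof.
by move=> Ji pJ; rewrite [p]mpolyE; apply: ideal_sum => // M /pJ; apply: idealZ.
Qed.

Lemma mpolyX_dvd_ideal J M N : is_ideal J -> (M <= N)%MM -> 'X_[M] \in J -> 'X_[N] \in J.
Proof. by move=> Ji /submK <- MJ; rewrite mpolyXD idealM. Qed.

Lemma monomial_ideal_msupp G p N :
  p \in monomial_ideal G -> N \in msupp p -> exists2 M, G M & (M <= N)%MM.
Proof.
move=> /ideal_genP[s sG ->] /msupp_sum_le/flattenP[? /mapP[x]].
rewrite mem_filter /= => /sG[M GM xM] ->.
move=> /msuppM_le/allpairsP[[K L] /= [_ + ->]].
by rewrite xM => /mem_msuppXP <-; exists M; rewrite ?lem_addl.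
Qed.

Lemma monomial_idealP G N :
  'X_[k, N] \in monomial_ideal G <-> exists2 M, G M & (M <= N)%MM.
Proof.
split=> [/monomial_ideal_msupp|[M GM MN]]; first by apply; rewrite msuppX mem_head.
apply: mpolyX_dvd_ideal MN _; first exact: ideal_gen_ideal.
by apply: mem_ideal_gen; exists M.
Qed.

Lemma monomial_ideal_monomial G : is_monomial_ideal (monomial_ideal G : {pred R}).
Proof.
split=> [|p pG N Np]; first exact: ideal_gen_ideal.
by apply/monomial_idealP; apply: monomial_ideal_msupp pG Np.
Qed.

Lemma eq_monomial_ideal J G : is_monomial_ideal J ->
  (forall N, 'X_[N] \in J <-> exists2 M, G M & (M <= N)%MM) ->
  J =i monomial_ideal G.
Proof.
move=> [Ji Jm] JG p; have [Gi Gm] := monomial_ideal_monomial G.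
apply/idP/idP => pJ; apply: mem_of_msupp => // N Np.
  by apply/monomial_idealP/JG; apply: Jm pJ _ Np.
by apply/JG/monomial_idealP; apply: Gm pJ _ Np.
Qed.

Section MinimalGenerators.
Variable J : {pred R}.
Hypothesis Jm : is_monomial_ideal J.

Definition div_minimal M : Prop :=
  'X_[M] \in J /\ forall N, 'X_[N] \in J -> (N <= M)%MM -> N = M.

Lemma div_minimal_below N : 'X_[N] \in J -> exists2 M, div_minimal M & (M <= N)%MM.
Proof.
have [d leNd] := ubnP (mdeg N); elim: d => // d IHd in N leNd *; move=> NJ.
have [[K [KJ KN neq]]|noK] :=
    pselect (exists K, [/\ 'X_[K] \in J, (K <= N)%MM & K <> N]).
  have [|//|M Mmin MK] := IHd K; last by exists M => //; apply: lepm_trans KN.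
  have eqN := submK KN; rewrite -eqN mdegD in leNd.
  suff : mdeg (N - K) != 0%N by lia.
  by apply: contra_notN neq; rewrite mdeg_eq0 => /eqP E; rewrite -eqN E add0m.
exists N; rewrite ?lepm_refl //; split=> // K KJ KN.
by apply: contrapT => neq; case: noK; exists K.
Qed.

Lemma div_minimal_gens : J =i monomial_ideal div_minimal.
Proof.
apply: eq_monomial_ideal => // N; split=> [|[M [MJ _] MN]].
  exact: div_minimal_below.
by apply: mpolyX_dvd_ideal MN MJ; case: Jm.
Qed.

Lemma div_minimal_sub G : J =i monomial_ideal G -> forall M, div_minimal M -> G M.
Proof.
move=> JG M [MJ Mmin]; have := MJ; rewrite JG => /monomial_idealP[N GN NM].
by rewrite -(Mmin N) // JG; apply: mem_ideal_gen; exists N.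
Qed.

(** Every generating set of monomials contains the divisibility-minimal ones, and these already
    generate; so there is just one minimal set. *)
Lemma min_monomial_genP M : min_monomial_gen J M <-> div_minimal M.
Proof.
split=> [[G [JG Gmin] GM]|Mmin].
  exact: (Gmin div_minimal (div_minimal_sub JG) div_minimal_gens).
exists div_minimal => //; split=> [|G _ JG]; first exact: div_minimal_gens.
exact: div_minimal_sub.
Qed.

(** Dickson's lemma makes the minimal generators finite in number, so a bound exists and the default
    0 does not occur. *)
Lemma le_max_exponent i M : min_monomial_gen J M -> (M i <= max_exponent J i)%N.
Proof.
move=> Mgen; rewrite /max_exponent; case: pselect => [ex|[]].
  by case: ex_minnP => e /asboolP + _; apply.
have [B BG BP] := dickson (min_monomial_gen J).
exists (\max_(N <- B) N i)%N; apply/asboolP => N Ngen.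
have [K KB KN] := BP N Ngen.
have /min_monomial_genP[KJ _] := BG K KB.
have /min_monomial_genP[_ Nmin] := Ngen.
by rewrite -(Nmin K KJ KN) (big_rem _ KB) leq_maxl.
Qed.

End MinimalGenerators.

Section InitialIdeal.
Variable le : rel 'X_{1..n}.
Hypothesis leT : term_order le.

Lemma lead_mulX f K M :
  is_lead_monomial le f M -> is_lead_monomial le (f * 'X_[K]) (M + K)%MM.
Proof.
move=> [Mf Mmax]; split; first by rewrite -mem_msuppMX.
move=> N /msuppM_le/allpairsP[[N' L] /= [/Mmax NM + ->]].
by move=> /mem_msuppXP <-; apply: to_mul.
Qed.

Lemma initial_ideal_monomial J : is_monomial_ideal (initial_ideal le J).
Proof. exact: monomial_ideal_monomial. Qed.

(** Leading monomials of elements of an ideal are closed under multiples, so they exhaust the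
    monomials of the initial ideal. *)
Lemma initial_idealP J N : is_ideal J ->
  'X_[N] \in initial_ideal le J <-> exists2 f, f \in J & is_lead_monomial le f N.
Proof.
move=> Ji; split=> [/monomial_idealP[M [f fJ fM] MN]|[f fJ fN]].
  exists (f * 'X_[N - M]); first by rewrite mulrC idealM.
  by rewrite -{2}(submK MN) addmC; apply: lead_mulX.
by apply/monomial_idealP; exists N; [exists f | exact: lepm_refl].
Qed.

End InitialIdeal.

(* Both hypotheses of the theorem on the generators of a monomial ideal have
   this form, which survives the passage from [J] to the initial ideal of
   [J + (f)] as soon as [P] ignores the variables of [f]. *)
Definition reducible P (x : 'I_n) J : Prop :=
  forall N, P N -> 'X_[N] \in J -> 'X_[N - U_(x)] \in J.

Lemma reducible_initial le P x J f :
  term_order le -> is_monomial_ideal J ->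
  (forall N, P N -> (U_(x) <= N)%MM) ->
  {in msupp f, forall M N, P (N + M)%MM = P N} ->
  reducible P x J -> reducible P x (initial_ideal le (add_gen J f)).
Proof.
move=> leT [Ji Jm] Px Pf redJ N PN.
have Ai := ideal_gen_ideal (fun g => g \in J \/ g = f).
move=> /(initial_idealP leT _ Ai)[p /(add_genP _ _ Ji)[j jJ [g def_p]] [Np Nmax]].
have filter_dvd u : exists v, mfilter P u = v * 'X_[U_(x)].
  by apply: mpolyX_dvd => M; rewrite msupp_mfilter => /andP[/Px].
have [j' def_j'] := filter_dvd j; have [g' def_g'] := filter_dvd g.
have j'J : j' \in J.
  apply: mem_of_msupp => // M; rewrite (mem_msuppMX _ U_(x)) -def_j' msupp_mfilter.
  case/andP=> PM Mj; rewrite -[M](addmK U_(x)); apply: redJ => //.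
  exact: Jm jJ _ Mj.
have def_fp : mfilter P p = (j' + g' * f) * 'X_x.
  by rewrite def_p mfilterD mfilterM // def_j' def_g' mulrDl -!mulrA ['X_x * f]mulrC.
apply/(initial_idealP leT _ Ai); exists (j' + g' * f).
  by apply/(add_genP _ _ Ji); exists j' => //; exists g'.
split=> [|M]; rewrite (mem_msuppMX _ U_(x)) -def_fp msupp_mfilter ?submK ?Px //.
  by rewrite PN.
by case/andP=> _ /Nmax MN; apply: (to_cancel leT (K := U_(x))); rewrite submK ?Px.
Qed.

Section Regular.
Variables (J : {pred R}) (f : R).
Hypothesis Jm : is_monomial_ideal J.

(* If [x] occurs in [f] exactly in the term [x], then the monomials of [g] with
   the largest exponent of [x], multiplied by [x], cannot cancel in [f * g]. *)
Lemma top_monomial_mul (x : 'I_n) g M :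
  f@_U_(x) = 1 -> {in msupp f, forall N, N != U_(x)%MM -> N x = 0%N} ->
  f * g \in J -> M \in msupp g -> {in msupp g, forall N, (N x <= M x)%N} ->
  'X_[M + U_(x)] \in J.
Proof.
case: Jm => Ji Jmon fx1 fx fgJ Mg Mmax; apply: Jmon fgJ _ _.
rewrite (mfilter_split (pred1 U_(x)%MM) f) mulrDl.
have -> : mfilter (pred1 U_(x)%MM) f = 'X_x.
  apply/mpolyP => N; rewrite mcoeff_mfilter /= mcoeffX eq_sym.
  by case: eqP => // <-.
suff rest0 : (M + U_(x))%MM \notin msupp (mfilter (predC (pred1 U_(x)%MM)) f * g).
  rewrite mcoeff_msupp mcoeffD (memN_msupp_eq0 rest0) addr0.
  by rewrite mulrC addmC mcoeffMX -mcoeff_msupp.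
(* The other terms of [f] are free of [x], so their products with [g] have exponent at most [M x] at
   [x]. *)
apply/negP=> /msuppM_le/allpairsP[[K L] /= [+ /Mmax Lx E]].
rewrite msupp_mfilter => /andP[/= /fx Kx /Kx{}Kx].
by have := congr1 (fun N : 'X_{1..n} => N x) E; rewrite !mnmDE mnm1E eqxx Kx; lia.
Qed.

End Regular.

Lemma exists_top_monomial (x : 'I_n) g M0 : M0 \in msupp g ->
  exists2 M, M \in msupp g & {in msupp g, forall N, (N x <= M x)%N}.
Proof.
move=> M0g; pose r := [rel M N : 'X_{1..n} | (M x <= N x)%N].
have r_tr : transitive r by move=> ? ? ? /=; apply: leq_trans.
have r_tot : total r by move=> ? ? /=; apply: leq_total.
have [|M Mg Mmax] := total_seq_max (s := msupp g) r_tr r_tot.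
  by apply: contraTneq M0g => ->.
by exists M.
Qed.

End Ideals.

(** * Regularity of a sum of distinct variables modulo a monomial ideal *)

Section SumOfVariables.
Variables (n : nat) (k : fieldType).
Local Notation R := {mpoly k[n]}.
Variables (c : nat -> 'I_n) (t : nat).
Hypothesis c_inj : forall i j, (i <= t)%N -> (j <= t)%N -> c i = c j -> i = j.

Definition sum_vars : R := \sum_(0 <= j < t.+1) 'X_(c j).

Lemma msupp_sum_vars M :
  M \in msupp sum_vars -> exists2 j, (j <= t)%N & M = U_(c j)%MM.
Proof.
move/msupp_sum_le/flattenP=> [_ /mapP[j + ->]].
rewrite mem_filter mem_index_iota /= => jt.
by move/mem_msuppXP <-; exists j.
Qed.

Lemma mcoeff_sum_vars j : (j <= t)%N -> sum_vars@_U_(c j) = 1.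
Proof.
move=> jt; rewrite raddf_sum /= (bigD1_seq j) ?iota_uniq ?mem_index_iota //=.
rewrite mcoeffXU eqxx big1_seq ?addr0 // => i.
rewrite mem_index_iota /= => /andP[ij it]; rewrite mcoeffXU.
by case: (c i =P c j) => // /c_inj E; rewrite E ?eqxx in ij.
Qed.

Lemma sum_vars_nonconst (a : k) : sum_vars <> a%:MP.
Proof.
move=> /(congr1 (mcoeff U_(c 0))) /eqP; rewrite mcoeff_sum_vars // mcoeffC.
by rewrite mnm1_eq0 mulr0 oner_eq0.
Qed.

Definition square_at (j : nat) : pred 'X_{1..n} := fun M => (1 < M (c j))%N.

Definition only_c0 : pred 'X_{1..n} := fun M =>
  (0 < M (c 0))%N && all (fun j => M (c j) == 0%N) (iota 1 t).

Variable J : {pred R}.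
Hypothesis Jm : is_monomial_ideal J.
Hypothesis J_square : forall j, (1 <= j <= t)%N -> reducible (square_at j) (c j) J.
Hypothesis J_c0 : reducible only_c0 (c 0) J.

(** Discard from [g] its monomials in [J], leaving [g']. A monomial of [g'] of top exponent in
    [c j], times [c j], lies in [J]. If [c j] with [j >= 1] occurred in [g'], this product would be
    divisible by the square of [c j], and reducibility would put the monomial itself in [J]. So [g']
    is free of these variables, and the same argument at [c 0] gives [g' = 0]. *)
Lemma sum_vars_regular : regular_on J sum_vars.
Proof.
have [Ji Jmon] := Jm; split=> [|g fgJ].
  apply: ideal_sum => [|j _]; first exact: ideal_gen_ideal.
  by apply: mem_ideal_gen; exists (c j).
pose PJ M := 'X_[k, M] \in J; pose g' := mfilter (predC PJ) g.
have gJ : mfilter PJ g \in J.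
  by apply: mem_of_msupp => // M; rewrite msupp_mfilter => /andP[].
have fgJ' : sum_vars * g' \in J.
  have -> : g' = g - mfilter PJ g 
    by apply/eqP; rewrite eq_sym subr_eq addrC /g' -mfilter_split.
  by rewrite mulrBr idealB // idealM.
have g'J M : M \in msupp g' -> 'X_[M] \notin J.
  by rewrite msupp_mfilter => /andP[].
have top j M : (j <= t)%N -> M \in msupp g' ->
    exists2 K, K \in msupp g' & 'X_[K + U_(c j)] \in J /\ (M (c j) <= K (c j))%N.
  move=> jt Mg; have [K Kg Kmax] := exists_top_monomial (c j) Mg.
  exists K => //; split; last exact: Kmax.
  apply: top_monomial_mul fgJ' Kg Kmax => //; first exact: mcoeff_sum_vars.
  move=> _ /msupp_sum_vars[i it ->]; rewrite eq_mnm1 mnm1E.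
  by move/negPf->.
have no_cj M j : (1 <= j <= t)%N -> M \in msupp g' -> M (c j) = 0%N.
  move=> jt Mg; apply/eqP; rewrite -leqn0 leqNgt; apply/negP => Mj.
  have [|K Kg [KJ Kj]] := top j M _ Mg; first by case/andP: jt.
  case/negP: (g'J K Kg); rewrite -[K](addmK U_(c j)); apply: J_square KJ => //.
  by rewrite /square_at mnmDE mnm1E eqxx; lia.
suff g'0 : g' = 0 by rewrite [g](mfilter_split PJ) -/g' g'0 addr0.
apply/eqP; rewrite -msupp_eq0; case E: (msupp g') => [//|M s].
have [//||K Kg [KJ _]] := top 0%N M; first by rewrite E mem_head.
case/negP: (g'J K Kg); rewrite -[K](addmK U_(c 0)); apply: J_c0 KJ.
rewrite /only_c0 mnmDE mnm1E eqxx addn1 /=; apply/allP => j.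
rewrite mem_iota add1n ltnS => jt; have /andP[j0 jt'] := jt.
rewrite mnmDE no_cj // mnm1E; case: (c 0 =P c j) => // /c_inj j00.
by move: j0; rewrite -j00.
Qed.

End SumOfVariables.

(** * Reducibility along the chain of initial ideals *)

Section InitiallyRegular.
Variables (k : fieldType) (n : nat) (I : {pred {mpoly k[n]}}).
Variables (le : rel 'X_{1..n}) (leT : term_order le).
Variables (q : nat) (t : 'I_q -> nat) (b : 'I_q -> nat -> 'I_n).
Hypothesis b_distinct : forall (i i' : 'I_q) (j j' : nat),
  (j <= t i)%N -> (j' <= t i')%N -> b i j = b i' j' -> i = i' /\ j = j'.
Hypothesis exp_le1 : forall (i : 'I_q) (j : nat), (1 <= j <= t i)%N ->
  (max_exponent (initial_ideal le I) (b i j) <= 1)%N.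
Hypothesis b0_dvd : forall (i : 'I_q) (M : 'X_{1..n}),
  min_monomial_gen (initial_ideal le I) M -> (U_(b i 0%N) <= M)%MM ->
  exists2 j : nat, (1 <= j <= t i)%N & (U_(b i j) <= M)%MM.

Definition fseq : seq {mpoly k[n]} := [seq sum_vars k (b i) (t i) | i <- enum 'I_q].

Lemma nth_fseq (i : 'I_q) : fseq`_i = sum_vars k (b i) (t i).
Proof. by rewrite (nth_map i) ?size_enum_ord // nth_ord_enum. Qed.

Lemma init_chain_monomial m : is_monomial_ideal (init_chain le I fseq m).
Proof. by case: m => [|m]; exact: initial_ideal_monomial. Qed.

Lemma dvd_subU (M N : 'X_{1..n}) x :
  (M <= N)%MM -> (M x < N x)%N -> (M <= N - U_(x))%MM.
Proof.
move=> /mnm_lepP MN Mx; apply/mnm_lepP => y; rewrite mnmBE mnm1E.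
by case: eqP => [<-|_]; [lia | rewrite subn0].
Qed.

(** Both properties for [i] last until the ideal on which the entry [i] must be regular: each
    earlier entry [m] involves only variables [b m j], distinct from all [b i j]. *)
Lemma init_chain_reducible m (i : 'I_q) : (m <= i)%N ->
  (forall j, (1 <= j <= t i)%N ->
     reducible (square_at (b i) j) (b i j) (init_chain le I fseq m)) /\
  reducible (only_c0 (b i) (t i)) (b i 0) (init_chain le I fseq m).
Proof.
elim: m => [|m IHm] mi /=.
  have Im := initial_ideal_monomial le I; have [Ii _] := Im.
  split=> [j jt N Nj|N /andP[N0 /allP Nj]] /div_minimal_below[M];
    move=> /(min_monomial_genP Im) Mgen MN; have [MI _] := (min_monomial_genP Im M).1 Mgen;
    apply: mpolyX_dvd_ideal MI => //; apply: dvd_subU => //.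
    exact: leq_ltn_trans (leq_trans (le_max_exponent Im _ Mgen) (exp_le1 jt)) Nj.
  (* If [b i 0] divided [M], then by [b0_dvd] some [b i j] with [j >= 1] would divide [M], hence
     [N], against the choice of [N]. *)
  have [-> //|] := posnP (M (b i 0)); rewrite lt0n -lep1mP => b0M.
  have [j jt bjM] := b0_dvd Mgen b0M; have := Nj j; rewrite mem_iota add1n ltnS.
  move=> /(_ jt) /eqP Nj0; move: bjM; rewrite lep1mP => /eqP[].
  by apply/eqP; rewrite -leqn0 -Nj0; apply/mnm_lepP.
have mq : (m < q)%N by apply: leq_trans mi (ltnW (ltn_ord i)).
have [IHs IH0] := IHm (ltnW mi); have Jm := init_chain_monomial m.
have -> : fseq`_m = sum_vars k (b (Ordinal mq)) (t (Ordinal mq)) by rewrite -nth_fseq.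
have off M N j : (j <= t i)%N ->
    M \in msupp (sum_vars k (b (Ordinal mq)) (t (Ordinal mq))) ->
    (N + M)%MM (b i j) = N (b i j).
  move=> jt /msupp_sum_vars[j' jt' ->]; rewrite mnmDE mnm1E; case: (b _ _ =P b _ _) => [|_].
    by move=> /b_distinct[] // [] /(congr1 val) /= E; rewrite E ltnn in mi.
  by rewrite addn0.
split=> [j jt|].
  apply: reducible_initial => // [N|M Mf N|]; last exact: IHs.
    by rewrite lep1mP /square_at; case: (N _).
  by rewrite /square_at (off _ _ _ _ Mf) //; case/andP: jt.
apply: reducible_initial => // [N|M Mf N].
  by case/andP; rewrite lep1mP lt0n.
rewrite /only_c0 (off _ _ _ _ Mf) //; congr (_ && _).
apply: eq_in_all => j; rewrite mem_iota add1n ltnS => /andP[_ jt].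
by rewrite (off _ _ _ _ Mf).
Qed.

Lemma fseq_initially_regular : initially_regular le I fseq.
Proof.
move=> m; rewrite size_map size_enum_ord => mq; pose i := Ordinal mq.
have b_inj j j' : (j <= t i)%N -> (j' <= t i)%N -> b i j = b i j' -> j = j'.
  by move=> jt jt' /b_distinct[].
have [Hs H0] := @init_chain_reducible m i (leqnn m).
rewrite (nth_fseq i); split; first exact: sum_vars_nonconst.
exact: sum_vars_regular (init_chain_monomial m) Hs H0.
Qed.

End InitiallyRegular.

(** * The Koszul cochain complex with coefficients in a module *)

Section Koszul.
Variables (A : comNzRingType) (T : Type) (x : T -> A).

(* The Koszul cochains of [i :: s] are two copies of those of [s]: the pair
   [(u, v)] stands for [u + e_i v]. *)
Fixpoint kos (N : lmodType A) (s : seq T) : lmodType A :=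
  if s is _ :: s' then (kos N s' * kos N s')%type : lmodType A else N.

Section Operators.
Variable N : lmodType A.

Fixpoint kd s : kos N s -> kos N s :=
  if s is i :: s' return kos N s -> kos N s
  then fun c => (kd c.1, x i *: c.1 - kd c.2) else fun=> 0.

Fact kd_linear s : linear (@kd s).
Proof.
elim: s => [|i s IHs] a u v /=; first by rewrite scaler0 addr0.
congr (_, _); rewrite /= ?IHs // scalerDr !scalerA [x i * a]mulrC.
by rewrite opprD scalerBr !scalerA addrACA.
Qed.

HB.instance Definition _ s :=
  GRing.isLinear.Build A (kos N s) (kos N s) *:%R (@kd s) (@kd_linear s).

(* The component of degree [d]. *)
Fixpoint kdeg s d : kos N s -> kos N s :=
  if s is i :: s' return kos N s -> kos N s
  then fun c => (kdeg d c.1, if d is e.+1 then kdeg e c.2 else 0)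
  else fun c => if d is 0 then c else 0.

Fact kdeg_linear s d : linear (@kdeg s d).
Proof.
elim: s d => [|i s IHs] d a u v /=; first by case: d; rewrite // scaler0 addr0.
by congr (_, _); case: d => [|d]; rewrite /= ?IHs // scaler0 addr0.
Qed.

HB.instance Definition _ s d :=
  GRing.isLinear.Build A (kos N s) (kos N s) *:%R (@kdeg s d) (@kdeg_linear s d).

(** Together with [kout] below, this identifies [N] with the cochains of degree 0. *)
Fixpoint kin s : N -> kos N s :=
  if s is i :: s' return N -> kos N s then fun u => (kin s' u, 0) else id.

Fact kin_linear s : linear (@kin s).
Proof.
by elim: s => [|i s IHs] a u v //=; rewrite IHs; congr (_, _); rewrite /= scaler0 addr0.
Qed.

HB.instance Definition _ s :=
  GRing.isLinear.Build A N (kos N s) *:%R (@kin s) (@kin_linear s).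

Fixpoint kout s : kos N s -> N :=
  if s is i :: s' return kos N s -> N then fun c => kout c.1 else id.

Fact kout_linear s : linear (@kout s).
Proof. by elim: s => [|i s IHs] a u v //=; rewrite IHs. Qed.

HB.instance Definition _ s :=
  GRing.isLinear.Build A (kos N s) N *:%R (@kout s) (@kout_linear s).

(* Contraction with [a]: a homotopy between multiplication by
   [\sum_(i <- s) a i * x i] and zero. *)
Fixpoint kcontr (a : T -> A) s : kos N s -> kos N s :=
  if s is i :: s' return kos N s -> kos N s
  then fun c => (a i *: c.2 + kcontr a c.1, - kcontr a c.2) else fun=> 0.

Fact kcontr_linear a s : linear (@kcontr a s).
Proof.
elim: s => [|i s IHs] b u v /=; first by rewrite scaler0 addr0.
congr (_, _); rewrite /= !IHs; last by rewrite opprD scalerN.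
by rewrite !scalerDr !scalerA [a i * b]mulrC addrACA.
Qed.

HB.instance Definition _ a s :=
  GRing.isLinear.Build A (kos N s) (kos N s) *:%R (@kcontr a s) (@kcontr_linear a s).

Lemma kdK s (c : kos N s) : kd (kd c) = 0.
Proof.
elim: s c => //= i s IHs c.
by rewrite IHs linearB linearZ /= IHs subr0 subrr.
Qed.

Lemma kdegK s d (c : kos N s) : kdeg d (kdeg d c) = kdeg d c.
Proof. by elim: s d c => [|i s IHs] [|d] c //=; rewrite !IHs. Qed.

Lemma kdeg0_kd s (c : kos N s) : kdeg 0 (kd c) = 0.
Proof. by elim: s c => //= i s IHs c; rewrite IHs. Qed.

Lemma kdegS_kd s d (c : kos N s) : kdeg d.+1 (kd c) = kd (kdeg d c).
Proof.
elim: s d c => //= i s IHs d c.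
rewrite IHs linearB linearZ /=; case: d => [|d]; last by rewrite IHs.
by rewrite kdeg0_kd [kd 0]linear0 oppr0.
Qed.

Lemma kdeg0_kin s u : kdeg 0 (kin s u) = kin s u.
Proof. by elim: s => //= i s ->. Qed.

Lemma koutK s u : kout (kin s u) = u.
Proof. by elim: s. Qed.

Lemma kd_kcontr a s (c : kos N s) :
  kd (kcontr a c) + kcontr a (kd c) = (\sum_(i <- s) a i * x i) *: c.
Proof.
elim: s c => [|i s IHs] /= => [c|[u v]]; first by rewrite big_nil scale0r addr0.
rewrite big_cons; congr (_, _) => /=.
  rewrite linearD linearZ /= scalerBr scalerA scalerDl -IHs addrACA.
  by congr (_ + _); rewrite addrC subrK.
rewrite linearB linearZ linearN /= scalerDr scalerA scalerDl -IHs opprK opprB.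
rewrite [x i * _]mulrC -!addrA; congr (_ + _).
by rewrite addrC !addrA subrK.
Qed.

Lemma kdeg0_kcontr a s (c : kos N s) : kcontr a (kdeg 0 c) = 0.
Proof. by elim: s c => //= i s IHs c; rewrite IHs scaler0 addr0 [kcontr a 0]linear0 oppr0. Qed.

Lemma kdeg_kcontr a s d (c : kos N s) : kdeg d (kcontr a c) = kcontr a (kdeg d.+1 c).
Proof.
elim: s d c => [|i s IHs] d c /=; first by case: d.
case: d => [|d]; rewrite linearD linearZ /= ?linearN /= !IHs //.
by rewrite kdeg0_kcontr oppr0.
Qed.

(** No degree is imposed on [e]: as [kd] raises degrees by one, only one component of [e]
    matters. *)
Definition kexact s q : Prop := forall d, (d < q)%N -> forall c : kos N s,
  kdeg d c = c -> kd c = 0 -> exists e, kd e = c.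

End Operators.
End Koszul.

Section Lifting.
Variable A : nzRingType.

(** The fibre product of [g] and [h], written as a kernel, surjects onto [P]. A section of this
    surjection followed by the projection to [U] is the lift. *)
Lemma projective_lift (P U V : lmodType A) (g : {linear U -> V}) (h : {linear P -> V}) :
  projective P -> (forall p, exists u, g u = h p) ->
  exists h' : {linear P -> U}, forall p, g (h' p) = h p.
Proof.
move=> Pproj gh; pose f : {linear (U * P)%type -> V} := (g \o fst) \- (h \o snd).
pose pr : {linear kernel f -> P} := snd \o val.
have [|s sP] := Pproj _ _ pr (idfun : {linear P -> P}).
  move=> p; have [u gu] := gh p.
  have up : (u, p) \in lin_ker f by rewrite unfold_in /= gu subrr.
  by exists (Kernel up).
exists (fst \o (val \o s)) => p /=; apply/eqP; rewrite -subr_eq0.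
by have := valP (s p); rewrite unfold_in /=; have /= -> := sP p.
Qed.

Section Pairing.
Variables (P U V : lmodType A) (g : {linear P -> U}) (h : {linear P -> V}).

Definition pair_fun (p : P) : U * V := (g p, h p).

Fact pair_fun_linear : linear pair_fun.
Proof. by move=> a p r; rewrite /pair_fun !linearP. Qed.

HB.instance Definition _ :=
  GRing.isLinear.Build A P (U * V)%type *:%R pair_fun pair_fun_linear.

End Pairing.

End Lifting.

(** * Cocycles on a projective resolution with values in a Koszul complex *)

Section Coboundaries.
Variables (A : comNzRingType) (M : lmodType A) (P : proj_resolution M).

Section OneModule.
Variable N : lmodType A.
Implicit Type d : nat.

Lemma coboundary_ext d (f g : {linear pr_mod P d -> N}) :
  f =1 g -> coboundary f -> coboundary g.
Proof.
move=> fg; case: d f g fg => [|d] f g fg /=; first by move=> f0 p; rewrite -fg.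
by case=> h fh; exists h => p; rewrite -fg.
Qed.

Lemma coboundary_sub d (f g : {linear pr_mod P d -> N}) :
  coboundary f -> coboundary g -> coboundary (f \- g).
Proof.
case: d f g => [|d] f g /=; first by move=> f0 g0 p; rewrite f0 g0 subrr.
by move=> [u fu] [v gv]; exists (u \- v) => p /=; rewrite fu gv.
Qed.

Lemma coboundary_cocycle d (f : {linear pr_mod P d -> N}) : coboundary f -> cocycle f.
Proof.
case: d f => [|d] f /= => [f0 p|[g fg] p]; first by rewrite f0.
have dd0 : pr_diff P d (pr_diff P d.+1 p) = 0 by apply/pr_exactS; exists p.
by rewrite fg dd0 linear0.
Qed.

End OneModule.

Lemma coboundary_comp (N N' : lmodType A) d (f : {linear pr_mod P d -> N})
    (g : {linear N -> N'}) : coboundary f -> coboundary (g \o f).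
Proof.
case: d f => [|d] f /=; first by move=> f0 p; rewrite f0 linear0.
by case=> h fh; exists (g \o h) => p /=; rewrite fh.
Qed.

Lemma coboundary_pair (N N' : lmodType A) d (f : {linear pr_mod P d -> (N * N')%type}) :
  coboundary (fst \o f) -> coboundary (snd \o f) -> coboundary f.
Proof.
case: d f => [|d] f /=; first (move=> f0 f1 p;
    rewrite [f p]surjective_pairing;
  exact: (f_equal2 pair (f0 p) (f1 p))).
move=> [g fg] [h fh]; exists (pair_fun g h) => p; rewrite [f p]surjective_pairing.
exact: (f_equal2 pair (fg p) (fh p)).
Qed.

(* Multiplication by [a] on the resolution lifts the zero map of [M], hence is
   homotopic to zero. *)
Lemma scale_nullhomotopic (a : A) : (forall m : M, a *: m = 0) ->
  exists2 h0 : {linear pr_mod P 0 -> pr_mod P 1},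
    forall y, pr_diff P 0 (h0 y) = a *: y &
  forall d, exists h : {linear pr_mod P d -> pr_mod P d.+1},
  exists h' : {linear pr_mod P d.+1 -> pr_mod P d.+2},
  forall y, pr_diff P d.+1 (h' y) + h (pr_diff P d y) = a *: y.
Proof.
move=> aM0.
have [h0 h0P] : exists h0 : {linear pr_mod P 0 -> pr_mod P 1},
    forall y, pr_diff P 0 (h0 y) = (a \*: idfun : {linear pr_mod P 0 -> pr_mod P 0}) y.
  apply: projective_lift => [|y]; first exact: pr_projective.
  by apply/pr_exact0; rewrite linearZ /= aM0.
exists h0 => // d.
have step e (h : {linear pr_mod P e -> pr_mod P e.+1}) :
    (forall y, pr_diff P e (h (pr_diff P e y)) = a *: pr_diff P e y) ->
    exists h' : {linear pr_mod P e.+1 -> pr_mod P e.+2},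
      forall y, pr_diff P e.+1 (h' y) + h (pr_diff P e y) = a *: y.
  move=> hP; pose g : {linear pr_mod P e.+1 -> pr_mod P e.+1} :=
    (a \*: idfun) \- (h \o pr_diff P e).
  have [||h' h'P] := @projective_lift _ _ _ _ (pr_diff P e.+1) g.
  - exact: pr_projective.
  - by move=> y; apply/pr_exactS; rewrite linearB linearZ /= hP subrr.
  by exists h' => y; rewrite h'P /= subrK.
(* It is enough to control the homotopy on boundaries; this condition passes to the next degree
   because consecutive differentials compose to zero. *)
suff [h hP] : exists h : {linear pr_mod P d -> pr_mod P d.+1},
    forall y, pr_diff P d (h (pr_diff P d y)) = a *: pr_diff P d y.
  by exists h; apply: step.
elim: d => [|d [h hP]]; first by exists h0 => y; rewrite h0P.
have [h' h'P] := step d h hP; exists h' => y.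
have := h'P (pr_diff P d.+1 y).
have -> : pr_diff P d (pr_diff P d.+1 y) = 0 by apply/pr_exactS; exists y.
by rewrite linear0 addr0.
Qed.

Lemma coboundary_scale (N : lmodType A) (a : A) d (f : {linear pr_mod P d -> N}) :
  (forall m : M, a *: m = 0) -> cocycle f -> coboundary (a \*: f).
Proof.
move=> /scale_nullhomotopic[h0 h0P hP]; case: d f => [|d] f fd /=.
  by move=> y; rewrite -linearZ /= -h0P fd.
have [h [h' hh']] := hP d; exists (f \o h) => y /=.
by rewrite -linearZ /= -hh' linearD fd add0r.
Qed.

Section KoszulCoefficients.
Variables (T : Type) (x : T -> A).
Hypothesis xM0 : forall i (m : M), x i *: m = 0.
Variable N : lmodType A.

Lemma coboundary_kos (s : seq T) d :
  (forall f : {linear pr_mod P d -> N}, cocycle f -> coboundary f) ->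
  forall f : {linear pr_mod P d -> kos N s}, cocycle f -> coboundary f.
Proof.
move=> exN; elim: s => [|i s IHs] f fd; first exact: exN.
by apply: coboundary_pair; apply: IHs => p /=; rewrite fd.
Qed.

(** The entries of [kd] are zero or, up to sign, some [x i], which turns cocycles into coboundaries
    because it annihilates [M]. *)
Lemma coboundary_kd (s : seq T) d (f : {linear pr_mod P d -> kos N s}) :
  cocycle f -> coboundary (kd x (s := s) \o f).
Proof.
elim: s f => [|i s IHs] f fd.
  by case: d f fd => [|d] f fd //=; exists (\0 : {linear _ -> _}).
pose f1 : {linear pr_mod P d -> kos N s} := fst \o f.
pose f2 : {linear pr_mod P d -> kos N s} := snd \o f.
have f1d : cocycle f1 by move=> p /=; rewrite /= fd.
have f2d : cocycle f2 by move=> p /=; rewrite /= fd.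
apply: coboundary_pair.
  by apply: coboundary_ext (IHs f1 f1d) => p.
apply: coboundary_ext (coboundary_sub (coboundary_scale (xM0 i) f1d) (IHs f2 f2d)).
by move=> p.
Qed.

(** Let D be the differential of the resolution. Then [kd \o f = f' \o D], and [kd \o f'] is a
    cocycle since [kd] squares to zero, hence a coboundary by [exN]. Induction gives [g] with
    [kd \o g \o D = kd \o f]. So [f - g \o D] maps into the kernel of [kd]; by exactness and
    projectivity it is some [kd \o h], and [f - kd \o h] is the coboundary [g \o D]. *)
Lemma kos_zigzag (s : seq T) q a :
  kexact x N s q ->
  (forall e, (e < a)%N -> forall f : {linear pr_mod P e -> N}, cocycle f -> coboundary f) ->
  forall d (f : {linear pr_mod P a -> kos N s}), (a + d < q)%N ->
  kdeg d \o f =1 f -> coboundary (kd x (s := s) \o f) ->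
  exists g : {linear pr_mod P a -> kos N s}, coboundary (f \- (kd x (s := s) \o g)).
Proof.
move=> exK; elim: a => [|a IHa] exN d f dq fdeg.
  move=> /= df0; have [||g gP] := @projective_lift _ _ _ _ (kd x (s := s)) f.
  - exact: pr_projective.
  - by move=> p; apply: exK (fdeg p) (df0 p); rewrite add0n in dq.
  by exists g => p /=; rewrite gP subrr.
case=> f' /= f'P.
(* The induction hypothesis asks for homogeneous values; the sum of the two degrees stays the
   same. *)
pose f'd : {linear pr_mod P a -> kos N s} := kdeg d.+1 \o f'.
have Df'd p : f'd (pr_diff P a p) = kd x (f p).
  by rewrite /f'd /= -f'P kdegS_kd; have /= -> := fdeg p.
have [||||g] := IHa _ d.+1 f'd.
- by move=> e ea; apply: exN; apply: ltnW.
- by rewrite addnS -addSn.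
- by move=> p; rewrite /= kdegK.
- apply: coboundary_kos => [|p]; first exact: exN.
  have := Df'd p; rewrite /= => ->; exact: kdK.
move=> /coboundary_cocycle cg.
pose gd : {linear pr_mod P a -> kos N s} := kdeg d \o g.
have Dg p : kd x (gd (pr_diff P a p)) = kd x (f p).
  have E : kd x (g (pr_diff P a p)) = f'd (pr_diff P a p).
    by apply/eqP; rewrite eq_sym -subr_eq0; apply/eqP/cg.
  by rewrite -Df'd /gd /= -kdegS_kd E kdegK.
pose r : {linear pr_mod P a.+1 -> kos N s} := f \- (gd \o pr_diff P a).
have [||h hP] := @projective_lift _ _ _ _ (kd x (s := s)) r.
- exact: pr_projective.
- move=> p; apply: (exK d); first by apply: leq_ltn_trans dq; apply: leq_addl.
    by rewrite /r linearB /= kdegK; have /= -> := fdeg p.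
  by rewrite /r linearB /= [X in _ - X]Dg subrr.
exists h; exists gd => p /=.
by rewrite hP /r /= opprB addrC subrK.
Qed.

(** Let [f] take values in degree 0 of the Koszul complex. The zigzag makes it a coboundary up to
    some [kd \o g], which has no component of degree 0. *)
Lemma coboundary_of_kexact (s : seq T) q d (f : {linear pr_mod P d -> N}) :
  kexact x N s q -> (d < q)%N -> cocycle f -> coboundary f.
Proof.
move=> exK; have [m] := ubnP d; elim: m => // m IHm in d f *; rewrite ltnS => dm dq fd.
have [||||g /(coboundary_comp (kout (s := s) \o kdeg 0))] :=
    @kos_zigzag s q d exK _ 0 (kin s \o f).
- by move=> e ed f' f'd; apply: IHm => //; [apply: leq_trans ed dm | apply: ltn_trans dq].
- by rewrite addn0.
- by move=> p; rewrite /= kdeg0_kin.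
- by apply: coboundary_kd => p; rewrite /= fd linear0.
apply: coboundary_ext => p /=.
by rewrite linearB /= kdeg0_kd subr0 kdeg0_kin koutK.
Qed.

End KoszulCoefficients.
End Coboundaries.

Lemma ext_depth_ge (A : comNzRingType) (T : Type) (x : T -> A) (M N : lmodType A)
    (s : seq T) q :
  (forall i (m : M), x i *: m = 0) -> kexact x N s q -> natbar_ge (ext_depth M N) q.
Proof.
move=> xM0 exK; rewrite /ext_depth; case: pselect => // ex /=.
case: ex_minnP => d /asboolP[P [f [fd fb]]] _; rewrite leqNgt; apply/negP => dq.
exact: fb (coboundary_of_kexact xM0 exK dq fd).
Qed.

(** * Koszul cohomology of a quotient, computed modulo a submodule *)

Section Submodule.
Variables (A : comNzRingType) (N : lmodType A) (S : N -> Prop).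

Definition is_submod : Prop := S 0 /\ forall a u v, S u -> S v -> S (a *: u + v).

Hypothesis S_sub : is_submod.

Lemma submodD u v : S u -> S v -> S (u + v).
Proof. by case: S_sub => _ Slin Su Sv; rewrite -[u]scale1r; apply: Slin. Qed.

Lemma submodZ a u : S u -> S (a *: u).
Proof. by case: S_sub => S0 Slin Su; rewrite -[_ *: _]addr0; apply: Slin. Qed.

Lemma submodB u v : S u -> S v -> S (u - v).
Proof.
by move=> Su Sv; apply: submodD => //; rewrite -scaleN1r; apply: submodZ.
Qed.

End Submodule.

Section RelativeKoszul.
Variables (A : comNzRingType) (T : Type) (x : T -> A) (N : lmodType A).

Fixpoint kall (S : N -> Prop) (s : seq T) : kos N s -> Prop :=
  if s is i :: s' return kos N s -> Prop
  then fun c => kall S c.1 /\ kall S c.2 else S.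

Lemma kall_sub S (s : seq T) : is_submod S -> is_submod (kall S (s := s)).
Proof.
move=> [S0 Slin]; elim: s => //= i s [IH0 IHlin]; split=> // a u v [u1 u2] [v1 v2].
by split; apply: IHlin.
Qed.

Lemma kall_impl (S S' : N -> Prop) (s : seq T) (c : kos N s) :
  (forall u, S u -> S' u) -> kall S c -> kall S' c.
Proof. by move=> SS'; elim: s c => [|i s IHs] c /=; [exact: SS' | case=> /IHs ? /IHs]. Qed.

Lemma kall_scale (S S' : N -> Prop) a (s : seq T) (c : kos N s) :
  (forall u, S (a *: u) -> S' u) -> kall S (a *: c) -> kall S' c.
Proof. by move=> SS'; elim: s c => [|i s IHs] c /=; [exact: SS' | case=> /IHs ? /IHs]. Qed.

Lemma kall_scaleT (S : N -> Prop) a (s : seq T) (c : kos N s) :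
  (forall u, S (a *: u)) -> kall S (a *: c).
Proof. by move=> aS; elim: s c => /= [|i s IHs] c; [exact: aS | split; exact: IHs]. Qed.

Lemma kall_lift (S S' : N -> Prop) a (s : seq T) (c : kos N s) :
  (forall u, S' u -> exists v, S (u - a *: v)) -> kall S' c ->
  exists e, kall S (c - a *: e).
Proof.
move=> S'S; elim: s c => [|i s IHs] c /=; first exact: S'S.
by move=> [/IHs[e1 ce1] /IHs[e2 ce2]]; exists (e1, e2).
Qed.

Section Closed.
Variable S : N -> Prop.
Hypothesis S_sub : is_submod S.

Lemma kall_kd (s : seq T) (c : kos N s) : kall S c -> kall S (kd x c).
Proof.
elim: s c => [|i s IHs] c /=; first by case: S_sub.
move=> [c1 c2]; have s_sub := kall_sub s S_sub; split; first exact: IHs.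
by apply: (submodB s_sub); [apply: (submodZ s_sub) | apply: IHs].
Qed.

Lemma kall_kdeg (s : seq T) d (c : kos N s) : kall S c -> kall S (kdeg d c).
Proof.
elim: s d c => [|i s IHs] d c /=; first by case: d => //; case: S_sub.
move=> [c1 c2]; split; first exact: IHs.
by case: d => [|d]; [case: (kall_sub s S_sub) | apply: IHs].
Qed.

Lemma kall_kcontr a (s : seq T) (c : kos N s) : kall S c -> kall S (kcontr a c).
Proof.
elim: s c => [|i s IHs] c /=; first by case: S_sub.
move=> [c1 c2]; have s_sub := kall_sub s S_sub; split.
  by apply: (submodD s_sub); [apply: (submodZ s_sub) | apply: IHs].
by rewrite -scaleN1r; apply: (submodZ s_sub); apply: IHs.
Qed.

End Closed.

(* The Koszul cohomology of [N / S] vanishes below degree [q]. *)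
Definition kexact_mod (S : N -> Prop) (s : seq T) q : Prop :=
  forall d, (d < q)%N -> forall c : kos N s,
  kdeg d c = c -> kall S (kd x c) -> exists e, kall S (c - kd x e).

(* If [f] is regular on [N / S], the long exact sequence of cohomology shifts
   degrees by one, since [f] lies in the ideal of the [x i], which annihilates
   cohomology. *)
Lemma kexact_mod_regular (S S' : N -> Prop) (a : T -> A) (s : seq T) q :
  let f := \sum_(i <- s) a i * x i in
  is_submod S -> (forall u, S (f *: u) -> S u) ->
  (forall u, S u -> S' u) -> (forall u, S' (f *: u)) -> is_submod S' ->
  (forall u, S' u -> exists v, S (u - f *: v)) ->
  kexact_mod S' s q -> kexact_mod S s q.+1.
Proof.
move=> f S_sub f_reg SS' fS' S'_sub S'S exS' d dq c cd dc.
have s_sub := kall_sub s S_sub; have s_sub' := kall_sub s S'_sub.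
pose psi := kcontr a c.
have dpsi : kall S (f *: c - kd x psi).
  by rewrite -(kd_kcontr x a) addrAC subrr add0r; apply: kall_kcontr.
case: d dq cd => [|d] dq cd.
  (* In degree 0 the contraction [psi] vanishes, so [f *: c] itself has all entries in [S]. *)
  exists 0; rewrite linear0 subr0; apply: (kall_scale f_reg).
  by move: dpsi; rewrite /psi -{2}cd kdeg0_kcontr linear0 subr0.
have [|||e psie] := exS' d _ psi.
- by [].
- by rewrite /psi kdeg_kcontr cd.
- rewrite -[kd x psi](subKr (f *: c)); apply: (submodB s_sub').
    exact: kall_scaleT.
  exact: kall_impl dpsi.
(* Modulo [S], [psi] is [kd e + f *: g], so [f *: c], which is [kd psi], equals [f *: kd g]; then
   [f] cancels. *)
have [g psig] := kall_lift S'S psie; exists g; apply: (kall_scale f_reg).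
have := submodD s_sub dpsi (kall_kd S_sub psig).
by rewrite !linearB linearZ /= kdK subr0 addrA subrK.
Qed.

Section Quotient.
Variables (Q : lmodType A) (pi : {linear N -> Q}).

Fixpoint kmap (s : seq T) : kos N s -> kos Q s :=
  if s is i :: s' return kos N s -> kos Q s then fun c => (kmap c.1, kmap c.2) else pi.

Lemma kmap_linear (s : seq T) : linear (@kmap s).
Proof.
elim: s => [|i s IHs] a u v /=; first exact: linearP.
by congr (_, _); apply: IHs.
Qed.

HB.instance Definition _ s :=
  GRing.isLinear.Build A (kos N s) (kos Q s) *:%R (@kmap s) (@kmap_linear s).

Lemma kmap_kd (s : seq T) (c : kos N s) : kmap (kd x c) = kd x (kmap c).
Proof.
elim: s c => [|i s IHs] c /=; first exact: linear0.
by rewrite linearB linearZ /= !IHs.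
Qed.

Lemma kmap_kdeg (s : seq T) d (c : kos N s) : kmap (kdeg d c) = kdeg d (kmap c).
Proof.
by elim: s d c => [|i s IHs] [|d] c //=; rewrite ?linear0 // !IHs.
Qed.

Lemma kmap_eq0 (s : seq T) (c : kos N s) : kmap c = 0 <-> kall (fun u => pi u = 0) c.
Proof.
elim: s c => [|i s IHs] //= [u v] /=; rewrite -!IHs.
by split=> [[-> ->]|[-> ->]].
Qed.

Lemma kmap_surj (s : seq T) : (forall v, exists u, pi u = v) ->
  forall c : kos Q s, exists e, kmap e = c.
Proof.
move=> pi_surj; elim: s => [|i s IHs] c; first exact: pi_surj.
have [[u cu] [v cv]] := (IHs c.1, IHs c.2).
by exists (u, v); rewrite /= cu cv -surjective_pairing.
Qed.

Lemma kexact_quotient (s : seq T) q : (forall v, exists u, pi u = v) ->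
  kexact_mod (fun u => pi u = 0) s q -> kexact x Q s q.
Proof.
move=> pi_surj exN d dq c cd dc; have [u cu] := kmap_surj pi_surj c.
have [||e /kmap_eq0] := exN d dq (kdeg d u).
- exact: kdegK.
- by apply/kmap_eq0; rewrite kmap_kd kmap_kdeg cu cd.
rewrite linearB /= kmap_kdeg kmap_kd cu cd => /eqP; rewrite subr_eq0 => /eqP ce.
by exists (kmap e).
Qed.

End Quotient.
End RelativeKoszul.

(** * Weights of Koszul cochains and the descent from the initial ideal *)

Section WeightFiltration.
Variables (n : nat) (k : fieldType).
Local Notation R := {mpoly k[n]}.
Local Notation Rmod := (R^o : lmodType R).
Local Notation X := (fun i : 'I_n => 'X_i : R).
Implicit Types (s : seq 'I_n) (P : pred 'X_{1..n}) (w sh M N : 'X_{1..n}) (J : {pred R}).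

Lemma mfilter_mulX P i (p : R) :
  mfilter P ('X_i * p) = 'X_i * mfilter (fun M => P (M + U_(i))%MM) p.
Proof.
have coefXp (g : R) N : ('X_i * g)@_N = if (U_(i) <= N)%MM then g@_(N - U_(i)) else 0.
  case: ifPn => [UN|UN]; first by rewrite -{1}(submK UN) addmC mulrC mcoeffMX.
  apply: memN_msupp_eq0; apply: contraNN UN => /msuppM_le/allpairsP[[K L] /= [+ _ ->]].
  by move/mem_msuppXP <-; apply: lem_addr.
apply/mpolyP => N; rewrite mcoeff_mfilter !coefXp mcoeff_mfilter.
by case: (boolP (U_(i) <= N)%MM) => UN; rewrite ?if_same ?submK.
Qed.

(* Weights are shifted so that [kd] is homogeneous: the component indexed by a
   set [B] of variables carries the shift [\sum_(i \notin B) U_(i)]. *)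
Fixpoint kfilter P sh s : kos Rmod s -> kos Rmod s :=
  if s is i :: s' return kos Rmod s -> kos Rmod s
  then fun c => (kfilter P (sh + U_(i))%MM c.1, kfilter P sh c.2)
  else mfilter (fun M => P (M + sh)%MM).

Lemma kfilter_scale P sh s i (c : kos Rmod s) :
  kfilter P sh ('X_i *: c) = 'X_i *: kfilter P (sh + U_(i))%MM c.
Proof.
elim: s sh c => [|j s IHs] sh c /=.
  rewrite [LHS]mfilter_mulX; congr (_ * _).
  by apply: eq_bigl => M; rewrite -addmA [(U_(i) + sh)%MM]addmC.
by rewrite !IHs -!addmA [(U_(j) + _)%MM]addmC.
Qed.

Fact kfilter_zmod P sh s : zmod_morphism (@kfilter P sh s).
Proof.
elim: s sh => [|i s IHs] sh u v /=; last by congr (_, _); apply: IHs.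
by apply/mpolyP=> M; rewrite !(mcoeffB, mcoeff_mfilter); case: ifP; rewrite ?subr0.
Qed.

HB.instance Definition _ P sh s :=
  GRing.isZmodMorphism.Build (kos Rmod s) (kos Rmod s) (@kfilter P sh s)
    (@kfilter_zmod P sh s).

Lemma kfilter_kd P sh s (c : kos Rmod s) : kfilter P sh (kd X c) = kd X (kfilter P sh c).
Proof.
elim: s sh c => [|i s IHs] sh c /=; first exact: (raddf0 (kfilter P sh (s := [::]))).
by rewrite raddfB /= kfilter_scale !IHs.
Qed.

Lemma kfilter_kdeg P sh s d (c : kos Rmod s) :
  kfilter P sh (kdeg d c) = kdeg d (kfilter P sh c).
Proof.
elim: s sh d c => [|i s IHs] sh [|d] c //=; rewrite ?IHs //.
  exact: (raddf0 (kfilter P sh (s := [::]))).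
by rewrite raddf0.
Qed.

Lemma kfilterI P P' sh s (c : kos Rmod s) :
  kfilter P sh (kfilter P' sh c) = kfilter (predI P P') sh c.
Proof.
elim: s sh c => [|i s IHs] sh c /=; last by rewrite !IHs.
by apply/mpolyP => M; rewrite !mcoeff_mfilter /=; case: (P _); case: (P' _).
Qed.

Lemma eq_kfilter P P' sh s (c : kos Rmod s) : P =1 P' -> kfilter P sh c = kfilter P' sh c.
Proof.
move=> PP'; elim: s sh c => [|i s IHs] sh c /=; last by rewrite !IHs.
by apply: eq_bigl => M.
Qed.

Lemma kfilter_pred0 P sh s (c : kos Rmod s) : P =1 pred0 -> kfilter P sh c = 0.
Proof.
move=> P0; elim: s sh c => [|i s IHs] sh c /=; last by rewrite !IHs.
by apply/mpolyP => M; rewrite mcoeff_mfilter P0 mcoeff0.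
Qed.

Lemma kall_kfilter J P sh s (c : kos Rmod s) : is_monomial_ideal J ->
  kall (fun u : Rmod => u \in J) c -> kall (fun u : Rmod => u \in J) (kfilter P sh c).
Proof.
move=> [Ji Jm]; elim: s sh c => [|i s IHs] sh c /=; last first.
  by case=> cJ1 cJ2; split; apply: IHs.
move=> cJ; apply: mem_of_msupp => // M; rewrite msupp_mfilter => /andP[_ Mc].
exact: Jm cJ _ Mc.
Qed.

Fixpoint kweights sh s : kos Rmod s -> seq 'X_{1..n} :=
  if s is i :: s' return kos Rmod s -> seq 'X_{1..n}
  then fun c => kweights (sh + U_(i))%MM c.1 ++ kweights sh c.2
  else fun c => [seq (M + sh)%MM | M <- msupp (c : R)].

Lemma kfilter_id P sh s (c : kos Rmod s) :
  {in kweights sh c, forall w, P w} -> kfilter P sh c = c.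
Proof.
elim: s sh c => [|i s IHs] sh c /= Pc.
  apply/mpolyP => M; rewrite mcoeff_mfilter; case: ifPn => // nPM.
  apply/esym/memN_msupp_eq0; apply: contraNN nPM => Mc.
  by apply: Pc; apply: map_f.
rewrite !IHs -?surjective_pairing // => w wc; apply: Pc; rewrite mem_cat wc ?orbT //.
Qed.

Lemma kfilter_weight_neq0 w sh s (c : kos Rmod s) :
  w \in kweights sh c -> kfilter (pred1 w) sh c <> 0.
Proof.
elim: s sh c => [|i s IHs] sh c /=.
  move=> /mapP[M Mc ->] /(congr1 (mcoeff M)); rewrite mcoeff_mfilter /= eqxx mcoeff0.
  by move/eqP; rewrite mcoeff_eq0 Mc.
by rewrite mem_cat => /orP[/IHs w1|/IHs w2] [].
Qed.

Lemma kweights_nil sh s (c : kos Rmod s) : kweights sh c = [::] -> c = 0.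
Proof.
elim: s sh c => [|i s IHs] sh c /=.
  by case E: (msupp _) => // _; apply: msuppnil0.
case E1: (kweights _ c.1) => //= E2.
by rewrite [c]surjective_pairing (IHs _ _ E1) (IHs _ _ E2).
Qed.

Variable le : rel 'X_{1..n}.
Hypothesis leT : term_order le.

Local Notation kle w := (kfilter (fun M => le M w) 0%MM).
Local Notation klead w := (kfilter (pred1 w) 0%MM).

(** An entry has at most one monomial of shifted weight [w]; if all weights are at most [w], it
    leads the entry, since shifts cancel in the term order. *)
Lemma klead_initial J w sh s (c : kos Rmod s) : is_ideal J ->
  kfilter (fun M => le M w) sh c = c -> kall (fun u : Rmod => u \in J) c ->
  kall (fun u : Rmod => u \in initial_ideal le J) (kfilter (pred1 w) sh c).
Proof.
move=> Ji; elim: s sh c => [|i s IHs] sh /=; last first.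
  by move=> [u v] /= [uw vw] [uJ vJ]; split; apply: IHs.
move=> c cw cJ; have [Ii _] := initial_ideal_monomial le J.
apply: mem_of_msupp => // M; rewrite msupp_mfilter /= => /andP[/eqP Mw Mc].
apply/(initial_idealP leT _ Ji); exists c => //; split=> // N.
by rewrite -cw msupp_mfilter -Mw => /andP[/(to_cancel leT)].
Qed.

(** In each entry the part of weight [w] is a multiple of one monomial; if nonzero, that monomial
    leads an element of [J], which is rescaled to match the coefficient. *)
Lemma klead_lift J w sh s (c : kos Rmod s) : is_ideal J ->
  kall (fun u : Rmod => u \in initial_ideal le J) (kfilter (pred1 w) sh c) ->
  exists j : kos Rmod s, [/\ kall (fun u : Rmod => u \in J) j,
    kfilter (fun M => le M w) sh j = j
    & kfilter (pred1 w) sh j = kfilter (pred1 w) sh c].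
Proof.
move=> Ji; elim: s sh c => [|i s IHs] sh /=; last first.
  move=> c [/IHs[u [uJ uw uc]] /IHs[v [vJ vw vc]]]; exists (u, v).
  by rewrite /= uw vw uc vc.
move=> c; set p := mfilter _ c => pI; have [p0|] := eqVneq p 0.
  exists 0; rewrite p0; split; first exact: ideal0.
    exact: (raddf0 (kfilter (fun M => le M w) sh (s := [::]))).
  exact: (raddf0 (kfilter (pred1 w) sh (s := [::]))).
rewrite -msupp_eq0; case E: (msupp p) => [//|N N'] _.
have Np : N \in msupp p by rewrite E mem_head.
have [Ii Im] := initial_ideal_monomial le J.
have /(initial_idealP leT _ Ji)[f fJ [Nf Nmax]] := Im _ pI _ Np.
move: Np; rewrite msupp_mfilter /= => /andP[/eqP Nw _].
exists ((p@_N / f@_N) *: (f : R)); split; first exact: idealZ.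
  apply/mpolyP => M; rewrite mcoeff_mfilter; case: ifPn => // nle.
  rewrite mcoeffZ; apply/esym/eqP; rewrite mulf_eq0 mcoeff_eq0; apply/orP; right.
  by apply: contraNN nle => /Nmax MN; rewrite -Nw; apply: to_mul.
apply/mpolyP => M; rewrite mcoeff_mfilter /=; case: ifPn => [/eqP Mw|nMw].
  have /addIm-> : (M + sh = N + sh)%MM by rewrite Mw Nw.
  by rewrite mcoeffZ mulfVK // -mcoeff_msupp.
by rewrite /p mcoeff_mfilter /= (negPf nMw).
Qed.

Definition quot_kexact J s q : Prop := kexact_mod X (fun u : Rmod => u \in J) s q.

Lemma ideal_submod J : is_ideal J -> is_submod (fun u : Rmod => u \in J).
Proof.
move=> Ji; split; first exact: ideal0.
by move=> a u v uJ vJ; apply: idealD => //; apply: idealM.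
Qed.

(* Successive subtraction of leading forms: the leading form of a cocycle
   modulo [J] is a cocycle modulo the initial ideal, hence a coboundary there. *)
Lemma quot_kexact_initial J s q : is_ideal J ->
  quot_kexact (initial_ideal le J) s q -> quot_kexact J s q.
Proof.
move=> Ji exI d dq; have [Ii Im] := initial_ideal_monomial le J.
have s_sub := kall_sub s (ideal_submod Ji); have i_sub := kall_sub s (ideal_submod Ii).
(* Induction along the term order on a bound [w] for the weights of [c]. *)
suff below w (c : kos Rmod s) : kle w c = c -> kdeg d c = c ->
    kall (fun u : Rmod => u \in J) (kd X c) ->
    exists e, kall (fun u : Rmod => u \in J) (c - kd X e).
  move=> c cd dc; have [/kweights_nil->|c0] := eqVneq (kweights 0%MM c) [::].
    by exists 0; rewrite linear0 subr0; case: s_sub.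
  have [w _ wmax] := total_seq_max (to_trans leT) (to_total leT) c0.
  by apply: (below w) => //; apply: kfilter_id.
move: w c; elim/(to_ind leT) => w IHw c cw cd dc.
have lw_lead (e : kos Rmod s) : kle w (klead w e) = klead w e.
  rewrite kfilterI; apply: eq_kfilter => M /=; case: eqP => [->|_]; rewrite ?andbF //.
  by rewrite (to_refl leT).
have lead_lead (e : kos Rmod s) : klead w (klead w e) = klead w e.
  by rewrite kfilterI; apply: eq_kfilter => M /=; rewrite andbb.
have [||e] := exI d dq (klead w c).
- by rewrite -kfilter_kdeg cd.
- rewrite -kfilter_kd; apply: klead_initial => //; by rewrite kfilter_kd cw.
(* The correction must be cut down to degree [d]; it remains a coboundary, namely 0 if [d = 0]. *)
have [e' e'P] : exists e', kdeg d (kd X (klead w e)) = kd X e'.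
  case: d {IHw cd dq} => [|d]; first by exists 0; rewrite kdeg0_kd linear0.
  by exists (kdeg d (klead w e)); rewrite kdegS_kd.
move=> ce; have [j [jJ jw jlead]] : exists j : kos Rmod s,
    [/\ kall (fun u : Rmod => u \in J) j, kle w j = j
      & klead w j = klead w (klead w c - kd X e)].
  by apply: klead_lift => //; apply: kall_kfilter ce; exact: initial_ideal_monomial.
rewrite raddfB /= lead_lead kfilter_kd in jlead.
(* The parts of weight [w] cancel in [r], so only weights strictly below [w] remain. *)
pose r := c - kd X (klead w e) - j; pose c' := kdeg d r.
have c'w : kle w c' = c'.
  rewrite kfilter_kdeg; congr (kdeg d _).
  by rewrite /r !raddfB /= cw kfilter_kd lw_lead jw.
have c'lead : klead w c' = 0.
  rewrite kfilter_kdeg -[RHS](linear0 (kdeg d (s := s))); congr (kdeg d _).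
  by rewrite /r !raddfB /= kfilter_kd lead_lead jlead subrr.
have def_c' : c' = c - kd X e' - kdeg d j.
  by rewrite /c' !raddfB /= cd e'P.
have dc' : kall (fun u : Rmod => u \in J) (kd X c').
  rewrite def_c' !linearB /= kdK subr0; apply: (submodB s_sub) => //.
  by apply: kall_kd; [exact: ideal_submod | apply: kall_kdeg => //; exact: ideal_submod].
have jdJ : kall (fun u : Rmod => u \in J) (kdeg d j).
  by apply: kall_kdeg => //; exact: ideal_submod.
suff [e2 c'e2] : exists e2, kall (fun u : Rmod => u \in J) (c' - kd X e2).
  exists (e' + e2); have := submodD s_sub c'e2 jdJ; congr (kall _ _).
  by rewrite def_c' [kd _ (_ + _)]linearD opprD [RHS]addrA [LHS]addrAC subrK.
have [/kweights_nil->|c'0] := eqVneq (kweights 0%MM c') [::].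
  by exists 0; rewrite linear0 subr0; case: s_sub.
have [w' w'c' w'max] := total_seq_max (to_trans leT) (to_total leT) c'0.
have w'lead := kfilter_weight_neq0 w'c'.
apply: (IHw w') => //.
- case: (boolP (le w' w)) => // nw'w; case: w'lead; rewrite -c'w kfilterI.
  by apply: kfilter_pred0 => M /=; case: eqP => //= ->; apply: negbTE.
- by apply: contra_notN w'lead => /eqP->.
- exact: kfilter_id.
- exact: kdegK.
Qed.

End WeightFiltration.

(** * Koszul vanishing along an initially regular sequence, and depth *)

Section Depth.
Variables (n : nat) (k : fieldType).
Local Notation R := {mpoly k[n]}.
Local Notation X := (fun i : 'I_n => 'X_i : R).
Implicit Types (J : {pred R}) (f : R).

Lemma mvars_idealP f :
  f \in @mvars_ideal n k -> exists a : 'I_n -> R, f = \sum_(i <- enum 'I_n) a i * 'X_i.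
Proof.
move=> /ideal_genP[s sX ->]; elim: s sX => [|y s IHs] sX.
  by exists (fun=> 0); rewrite big_nil big1 // => i _; rewrite mul0r.
have [|a def_a] := IHs; first by move=> z zs; apply: sX; rewrite inE zs orbT.
have [|j def_y] := sX y; first exact: mem_head.
exists (fun i => (if i == j then y.1 else 0) + a i).
rewrite big_cons def_a def_y (eq_bigr _ (fun i _ => mulrDl _ _ _)) big_split /=.
congr (_ + _); rewrite (bigD1_seq j) ?enum_uniq ?mem_enum //= eqxx.
by rewrite big1 ?addr0 // => i /negPf->; rewrite mul0r.
Qed.

Lemma quot_kexact_regular J f q : is_ideal J -> regular_on J f ->
  quot_kexact (add_gen J f) (enum 'I_n) q -> quot_kexact J (enum 'I_n) q.+1.
Proof.
move=> Ji [/mvars_idealP[a def_f] f_reg].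
have Ai : is_ideal (add_gen J f) by apply: ideal_gen_ideal.
apply: (kexact_mod_regular (a := a)); rewrite -?def_f.
- exact: ideal_submod.
- exact: f_reg.
- by move=> u uJ; apply: mem_ideal_gen; left.
- move=> u; rewrite -[f *: u]mulrC; apply: idealM => //.
  by apply: mem_ideal_gen; right.
- exact: ideal_submod.
move=> u /(add_genP _ _ Ji)[j jJ [g ->]]; exists g.
have -> : f *: (g : R^o) = g * f by apply: mulrC.
by rewrite addrK.
Qed.

(** Induction from the end of the chain, where nothing is claimed as no degree is below 0. Each step
    back passes from in(J, f) to (J, f) by leading forms and to J by regularity of f, gaining one
    degree. *)
Lemma quot_kexact_initially_regular le (I : {pred R}) (fs : seq R) :
  term_order le -> is_ideal I -> initially_regular le I fs ->
  quot_kexact I (enum 'I_n) (size fs).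
Proof.
move=> leT Ii fs_reg; apply: (quot_kexact_initial leT Ii).
suff chain m : (m <= size fs)%N ->
    quot_kexact (init_chain le I fs (size fs - m)) (enum 'I_n) m.
  by have := chain _ (leqnn (size fs)); rewrite subnn.
elim: m => [|m IHm] ms; first by move=> d; rewrite ltn0.
have lt_fs : (size fs - m.+1 < size fs)%N by rewrite -{2}(subnKC ms) addSn addnC; lia.
have [_ f_reg] := fs_reg _ lt_fs; apply: quot_kexact_regular f_reg _.
  by case: (size fs - m.+1)%N => [|e]; apply: (initial_ideal_monomial le _).1.
apply: (quot_kexact_initial leT); first exact: ideal_gen_ideal.
by have := IHm (ltnW ms); rewrite -(subnSK ms).
Qed.

Section Ext.
Variable I : idealr R.

Lemma idealr_ideal : is_ideal I.
Proof.
split=> [|u v|a u]; [exact: rpred0 | exact: rpredD | ].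
by move=> uI; apply: idealMr.
Qed.

Definition quot_proj (u : R^o) : {ideal_quot I} := \pi_{ideal_quot I} (u : R).

Fact quot_proj_linear : linear quot_proj.
Proof. by move=> a u v; rewrite /quot_proj rmorphD rmorphM. Qed.

HB.instance Definition _ :=
  GRing.isLinear.Build R R^o {ideal_quot I} *:%R quot_proj quot_proj_linear.

Lemma quot_proj_surj v : exists u, quot_proj u = v.
Proof. by exists (repr v); rewrite /quot_proj reprK. Qed.

Lemma quot_proj_eq0 u : quot_proj u = 0 <-> u \in I.
Proof.
have -> : (u \in I) = (quot_proj u == 0).
  by rewrite -[u in LHS]subr0 Quotient.idealrBE /quot_proj -(rmorph0 (\pi_{ideal_quot I})).
by split=> /eqP.
Qed.

End Ext.

Lemma depth_ge (I : idealr R) q : quot_kexact I (enum 'I_n) q -> natbar_ge (depth I) q.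
Proof.
move=> exI; apply: (@ext_depth_ge _ _ X _ _ (enum 'I_n)) => [i m|].
  have [u <-] := quot_proj_surj m.
  rewrite -linearZ; apply/quot_proj_eq0; rewrite -[_ *: u]mulrC.
  by apply: idealMr; apply: mem_ideal_gen; exists i.
apply: (kexact_quotient (@quot_proj_surj I)) => d dq c cd dc.
have [|e ce] := exI d dq c cd.
  by apply: kall_impl dc => u /quot_proj_eq0.
by exists e; apply: kall_impl ce => u /quot_proj_eq0.
Qed.

End Depth.

Theorem theorem1p3 (k : fieldType) (n : nat) (I : idealr {mpoly k[n]})
    (le : rel 'X_{1..n}) (le_term : term_order le)
    (q : nat) (t : 'I_q -> nat) (b : 'I_q -> nat -> 'I_n)
    (b_distinct : forall (i i' : 'I_q) (j j' : nat),
       (j <= t i)%N -> (j' <= t i')%N -> b i j = b i' j' -> i = i' /\ j = j')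
    (b0_gt : forall (i : 'I_q) (j : nat), (1 <= j <= t i)%N ->
       le U_(b i j)%MM U_(b i 0%N)%MM /\ U_(b i j)%MM <> U_(b i 0%N)%MM)
    (hyp1 : forall (i : 'I_q) (j : nat), (1 <= j <= t i)%N ->
       (max_exponent (initial_ideal le I) (b i j) <= 1)%N)
    (hyp2 : forall (i : 'I_q) (M : 'X_{1..n}),
       min_monomial_gen (initial_ideal le I) M ->
       (U_(b i 0%N) <= M)%MM ->
       exists2 j : nat, (1 <= j <= t i)%N & (U_(b i j) <= M)%MM) :
  initially_regular le I
    [seq \sum_(0 <= j < (t i).+1) 'X_(b i j) | i <- enum 'I_q]
  /\ natbar_ge (depth I) q.
Proof.
have fs_reg := fseq_initially_regular le_term b_distinct hyp1 hyp2.
split; first exact: fs_reg.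
have := quot_kexact_initially_regular le_term (idealr_ideal I) fs_reg.
by rewrite size_map size_enum_ord; apply: depth_ge.
Qed.
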